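(* Let $n\ge 2$ and let $\varphi,\psi:[0,\infty)\to\mathbb{R}$ be smooth functions with $\varphi(0)=\psi(0)\neq 0$. Then the implicit differential equation $$\left(\frac{dw}{dt}\right)^2=\frac{1}{n-1}\left[(n-2)\varphi(t)(w^2-2w)+t^2\varphi(t)\psi(t)\right]$$ has a unique local smooth solution $w$ with initial condition $w(0)=w'(0)=0$, defined on an interval $[0,\epsilon)$ for some $\epsilon>0$, such that $w'(t)\varphi(0)>0$ for all $t\in(0,\epsilon)$.
   Context: Smooth means $C^\infty$ (up to and including the endpoint $t=0$). Uniqueness is local: two such solutions coincide on a small enough interval $[0,\epsilon)$. *)

(* Defs.v *)
From Stdlib Require Import Reals.
Open Scope R_scope.

(* C^infinity on a nondegenerate interval [D], including the endpoints that
   belong to [D]: [D_in f g D x] differentiates through points of [D] only, so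
   derivatives at an endpoint are one-sided and the values of [f] outside [D]
   are irrelevant.  [d k] is the k-th derivative. *)
Definition smooth_on (D : R -> Prop) (f : R -> R) : Prop :=
  exists d : nat -> R -> R,
    (forall x, D x -> d 0%nat x = f x) /\
    (forall k x, D x -> D_in (d k) (d (S k)) D x).

Definition half_line (t : R) : Prop := 0 <= t.

Definition initial_interval (eps t : R) : Prop := 0 <= t < eps.

Definition is_solution (n : nat) (phi psi : R -> R) (eps : R) (w : R -> R)
  : Prop :=
  0 < eps /\
  smooth_on (initial_interval eps) w /\
  exists w' : R -> R,
    (forall t, initial_interval eps t ->
       D_in w w' (initial_interval eps) t) /\
    w 0 = 0 /\ w' 0 = 0 /\
    (forall t, initial_interval eps t ->
       w' t ^ 2 =
       1 / (INR n - 1) *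
         ((INR n - 2) * phi t * (w t ^ 2 - 2 * w t)
          + t ^ 2 * phi t * psi t)) /\
    (forall t, 0 < t < eps -> w' t * phi 0 > 0).

(* Main.v *)
Require Import Defs.
From Stdlib Require Import Reals Lra Lia ClassicalEpsilon.
From Coquelicot Require Import Coquelicot.
Open Scope R_scope.

(** Write [c = phi 0], [a = (n-2)/(n-1)], [phi = c f], [psi = c g] and [w = c t^2 y].
    On the branch [w' c > 0] the equation becomes the regular singular equation
    [t y' + 2 y = sqrt (a f (c t^2 y^2 - 2 y) + (1 - a) f g)], which forces
    [y 0 = (1 - a) / 2].  After adding a multiple [m y] to both sides, integration
    against the weight [t^(m+1)] turns it into a fixed point equation for a
    contraction, whence a continuous solution.  Smoothness at [0] follows by
    bootstrapping: [p = y'] solves [t p' = A p + B] with [A 0 < -1] and [t p -> 0],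
    and such a [p] is as smooth as [A] and [B].  For uniqueness no desingularisation
    is needed: the right-hand side is monotone in [w] on the chosen branch. *)

(** * Fixed points of contractions on continuous functions *)

Lemma geometric_small (C q e : R) :
  0 <= C -> 0 <= q < 1 -> 0 < e -> exists k, C * q ^ k < e.
Proof.
intros HC Hq He.
destruct (pow_lt_1_zero q) with (y := e / (C + 1)) as [k Hk].
- rewrite Rabs_pos_eq; lra.
- apply Rdiv_lt_0_compat; lra.
- exists k; specialize (Hk k (le_n _)).
  assert (Hp : 0 <= q ^ k) by (apply pow_le; lra).
  rewrite Rabs_pos_eq in Hk by exact Hp.
  apply (Rmult_lt_compat_r (C + 1)) in Hk; [|lra].
  replace (e / (C + 1) * (C + 1)) with e in Hk by (field; lra).
  nra.
Qed.

(** Telescoping bounds [u (k + j) t - u k t] by [B / (1 - q) * (q ^ k - q ^ (k + j))], so the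
    sequence is Cauchy at each [t] at a rate independent of [t]. *)
Lemma geometric_uniform_limit (u : nat -> R -> R) (B q : R) :
  0 <= q < 1 ->
  (forall k t, Rabs (u (S k) t - u k t) <= B * q ^ k) ->
  exists l : R -> R, forall k t, Rabs (l t - u k t) <= B / (1 - q) * q ^ k.
Proof.
intros Hq Hu.
assert (Hkj : forall k j t,
  Rabs (u (k + j)%nat t - u k t) <= B / (1 - q) * (q ^ k - q ^ (k + j))).
{ intros k j t; induction j as [|j IH].
  - rewrite Nat.add_0_r, !Rminus_diag, Rabs_R0; lra.
  - rewrite Nat.add_succ_r.
    replace (u (S (k + j)) t - u k t)
      with ((u (S (k + j)) t - u (k + j)%nat t) + (u (k + j)%nat t - u k t))
      by ring.
    eapply Rle_trans; [apply Rabs_triang|].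
    eapply Rle_trans; [apply Rplus_le_compat; [apply Hu | apply IH]|].
    right; simpl; field; lra. }
assert (HC : 0 <= B / (1 - q)).
{ apply Rdiv_le_0_compat; [|lra].
  generalize (Rle_trans _ _ _ (Rabs_pos _) (Hu 0%nat 0)); simpl; lra. }
assert (Hle : forall k j t, Rabs (u (k + j)%nat t - u k t) <= B / (1 - q) * q ^ k).
{ intros k j t; eapply Rle_trans; [apply Hkj|].
  apply Rmult_le_compat_l; [exact HC|].
  assert (0 <= q ^ (k + j)) by (apply pow_le; lra); lra. }
assert (Hsmall := fun e => geometric_small (B / (1 - q)) q e HC Hq).
(* Stated as a sigma type, so that the limit function is read off by projection. *)
assert (Hcv : forall t, {l : R | Un_cv (fun k => u k t) l}).
{ intro t; apply Rcomplete.R_complete; intros e He.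
  destruct (Hsmall (e / 2)) as [K HK]; [lra|].
  exists K; intros i j Hi Hj; unfold Rdist.
  replace (u i t - u j t) with ((u i t - u K t) - (u j t - u K t)) by ring.
  eapply Rle_lt_trans; [apply Rabs_triang|]; rewrite Rabs_Ropp.
  replace i with (K + (i - K))%nat by lia.
  replace j with (K + (j - K))%nat by lia.
  generalize (Hle K (i - K)%nat t) (Hle K (j - K)%nat t); lra. }
exists (fun t => proj1_sig (Hcv t)); intros k t.
destruct (Hcv t) as [l Hl]; cbn [proj1_sig].
apply Rnot_lt_le; intro Hlt.
destruct (Hl (Rabs (l - u k t) - B / (1 - q) * q ^ k)) as [K HK]; [lra|].
specialize (HK (k + K)%nat ltac:(lia)); unfold Rdist in HK.
generalize (Hle k K t); intro HkK.
rewrite Rabs_minus_sym in HK.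
generalize (Rabs_triang (l - u (k + K)%nat t) (u (k + K)%nat t - u k t)).
replace (l - u (k + K)%nat t + (u (k + K)%nat t - u k t)) with (l - u k t) by ring.
lra.
Qed.

(** Picard iteration from the zero function. The sup norm enters only through uniform bounds [D];
    the limit is continuous as a uniform limit of continuous iterates. *)
Lemma contraction_fixed_point (T : (R -> R) -> R -> R) (B q : R) :
  0 <= q < 1 ->
  (forall u, continuity u -> continuity (T u)) ->
  (forall u v D, continuity u -> continuity v ->
     (forall t, Rabs (u t - v t) <= D) ->
     forall t, Rabs (T u t - T v t) <= q * D) ->
  (forall t, Rabs (T (fun _ => 0) t) <= B) ->
  exists y, continuity y /\ forall t, T y t = y t.
Proof.
intros Hq HTc HT HB.
set (u := fix u (k : nat) : R -> R :=
  match k with O => fun _ => 0 | S k => T (u k) end).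
assert (Huc : forall k, continuity (u k)).
{ induction k as [|k IH]; [|exact (HTc _ IH)].
  intro t; apply continuity_pt_const; intros ? ?; reflexivity. }
destruct (geometric_uniform_limit u B q Hq) as [y Hy].
{ induction k as [|k IH]; intro t.
  - cbn; rewrite Rminus_0_r, Rmult_1_r; apply HB.
  - change (Rabs (T (u (S k)) t - T (u k) t) <= B * q ^ S k).
    replace (B * q ^ S k) with (q * (B * q ^ k)) by (simpl; ring).
    now apply HT. }
set (C := B / (1 - q)) in *.
assert (HC : 0 <= C)
  by (generalize (Rle_trans _ _ _ (Rabs_pos _) (Hy 0%nat 0)); simpl; lra).
assert (Hsmall := fun e => geometric_small C q e HC Hq).
assert (Hyc : continuity y).
{ intros t e He.
  destruct (Hsmall (e / 3)) as [k Hk]; [lra|].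
  destruct (Huc k t (e / 3)) as [d [Hd Hud]]; [lra|].
  exists d; split; [exact Hd|]; intros x Hx.
  specialize (Hud x Hx); simpl in Hud |- *; unfold Rdist in *.
  replace (y x - y t)
    with ((y x - u k x) + (u k x - u k t) - (y t - u k t)) by ring.
  eapply Rle_lt_trans; [apply Rabs_triang|]; rewrite Rabs_Ropp.
  generalize (Rabs_triang (y x - u k x) (u k x - u k t)) (Hy k x) (Hy k t); lra. }
exists y; split; [exact Hyc|]; intro t.
apply Rminus_diag_uniq, Rabs_eq_0, Rle_antisym; [|apply Rabs_pos].
apply Rnot_lt_le; intro Hlt.
destruct (Hsmall (Rabs (T y t - y t) / 2)) as [k Hk]; [lra|].
generalize (HT y (u k) _ Hyc (Huc k) (Hy k) t) (Hy (S k) t); cbn [u].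
fold (u k).
replace (C * q ^ S k) with (q * (C * q ^ k)) by (simpl; ring).
rewrite (Rabs_minus_sym (y t)); intros H1 H2.
generalize (Rabs_triang (T y t - T (u k) t) (T (u k) t - y t)).
replace (T y t - T (u k) t + (T (u k) t - y t)) with (T y t - y t) by ring.
assert (0 <= C * q ^ k) by exact (Rle_trans _ _ _ (Rabs_pos _) (Hy k t)).
nra.
Qed.

(** * The singular equation t y' + (p+1) y = F(t, y) *)

(* By the substitution [s = t * x] this is [t^-(p+1)] times the integral of
   [s^p * h s] over [0, t]; unlike that form it also makes sense at [t = 0]. *)
Definition weighted_mean (p : nat) (h : R -> R) (t : R) : R :=
  RInt (fun x => x ^ p * h (t * x)) 0 1.

Lemma ex_RInt_weighted (p : nat) (h : R -> R) (t a b : R) :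
  continuity h -> ex_RInt (fun x => x ^ p * h (t * x)) a b.
Proof.
intro Hh; apply (ex_RInt_continuous (V := R_CompleteNormedModule)); intros x _.
apply continuity_pt_filterlim.
apply (continuity_pt_mult (fun x => x ^ p) (fun x => h (t * x))).
- apply derivable_continuous_pt, derivable_pt_pow.
- apply (continuity_pt_comp (fun x => t * x) h); [reg | apply Hh].
Qed.

(** The weight [x ^ p] has mass [1 / (p + 1)] on [0, 1]. Letting both the function and the point
    vary serves the contraction estimate and continuity in [t] alike. *)
Lemma weighted_mean_dist (p : nat) (h1 h2 : R -> R) (t1 t2 D : R) :
  continuity h1 -> continuity h2 ->
  (forall x, 0 <= x <= 1 -> Rabs (h1 (t1 * x) - h2 (t2 * x)) <= D) ->
  Rabs (weighted_mean p h1 t1 - weighted_mean p h2 t2) <= D / INR (S p).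
Proof.
intros H1 H2 HD; unfold weighted_mean.
assert (E1 := ex_RInt_weighted p h1 t1 0 1 H1).
assert (E2 := ex_RInt_weighted p h2 t2 0 1 H2).
assert (E := ex_RInt_minus _ _ _ _ E1 E2).
assert (Hm := RInt_minus _ _ _ _ E1 E2).
change (RInt (fun x => x ^ p * h1 (t1 * x)) 0 1 - RInt (fun x => x ^ p * h2 (t2 * x)) 0 1)
  with (minus (RInt (fun x => x ^ p * h1 (t1 * x)) 0 1) (RInt (fun x => x ^ p * h2 (t2 * x)) 0 1)).
rewrite <- Hm.
assert (HI : is_RInt (fun x => D * x ^ p) 0 1 (D * (1 ^ S p / INR (S p) - 0 ^ S p / INR (S p)))).
{ apply (is_RInt_scal (fun x : R => x ^ p)), is_RInt_pow. }
rewrite pow1, pow_i in HI by lia.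
replace (D * (1 / INR (S p) - 0 / INR (S p))) with (D / INR (S p)) in HI
  by (unfold Rdiv; ring).
refine (norm_RInt_le _ _ 0 1 _ _ Rle_0_1 _ (RInt_correct _ _ _ E) HI).
intros x Hx; change (Rabs (x ^ p * h1 (t1 * x) - x ^ p * h2 (t2 * x)) <= D * x ^ p).
rewrite <- Rmult_minus_distr_l, Rabs_mult, Rmult_comm.
rewrite (Rabs_pos_eq (x ^ p)) by (apply pow_le; lra).
apply Rmult_le_compat_r; [apply pow_le; lra | now apply HD].
Qed.

Lemma weighted_mean_const (p : nat) (c t : R) :
  weighted_mean p (fun _ => c) t = c / INR (S p).
Proof.
apply is_RInt_unique.
apply (is_RInt_ext (fun x => c * x ^ p)); [intros; apply Rmult_comm|].
replace (c / INR (S p)) with (c * (1 ^ S p / INR (S p) - 0 ^ S p / INR (S p))).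
- apply (is_RInt_scal (fun x : R => x ^ p)), is_RInt_pow.
- rewrite pow1, pow_i by lia; unfold Rdiv; ring.
Qed.

Lemma weighted_mean_0 (p : nat) (h : R -> R) :
  weighted_mean p h 0 = h 0 / INR (S p).
Proof.
rewrite <- (weighted_mean_const p (h 0) 0).
apply RInt_ext; intros x _; now rewrite Rmult_0_l.
Qed.

Lemma weighted_mean_continuity (p : nat) (h : R -> R) :
  continuity h -> continuity (weighted_mean p h).
Proof.
intros Hh t e He.
set (M := Rabs t + 1).
assert (Hu : uniform_continuity h (fun x => - M <= x <= M)).
{ apply Heine; [apply compact_P3 | intros; apply Hh]. }
destruct (Hu (mkposreal (e / 2) ltac:(lra))) as [d Hd]; simpl in Hd.
exists (Rmin d 1); split; [apply Rmin_pos; [apply cond_pos | lra]|].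
intros x [_ Hx]; simpl in *; unfold Rdist in *.
apply Rle_lt_trans with (e / 2 / INR (S p)).
- apply weighted_mean_dist; [exact Hh | exact Hh |]; intros z Hz.
  assert (Hxt : Rabs (x - t) < d) by (eapply Rlt_le_trans; [exact Hx | apply Rmin_l]).
  assert (Hx1 : Rabs (x - t) < 1) by (eapply Rlt_le_trans; [exact Hx | apply Rmin_r]).
  apply Rlt_le, Hd.
  + apply Rabs_le_between; rewrite Rabs_mult, (Rabs_pos_eq z) by lra.
    generalize (Rabs_triang_inv x t) (Rabs_pos x); unfold M; nra.
  + apply Rabs_le_between; rewrite Rabs_mult, (Rabs_pos_eq z) by lra.
    generalize (Rabs_pos t); unfold M; nra.
  + rewrite <- Rmult_minus_distr_r, Rabs_mult, (Rabs_pos_eq z) by lra.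
    generalize (Rabs_pos (x - t)); nra.
- assert (1 <= INR (S p)) by (rewrite S_INR; generalize (pos_INR p); lra).
  apply Rlt_div_l; nra.
Qed.

(** For [t > 0] the quotient rule applies to the integral over [0, t] divided by [t ^ S p]; thus the
    mean [y] of [h] solves [t y' + (p+1) y = h]. *)
Lemma is_derive_weighted_mean (p : nat) (h : R -> R) (t : R) :
  continuity h -> 0 < t ->
  is_derive (weighted_mean p h) t ((h t - INR (S p) * weighted_mean p h t) / t).
Proof.
intros Hh Ht.
set (k := fun s => s ^ p * h s).
assert (Hk : forall s, continuous k s).
{ intro s; apply continuity_pt_filterlim.
  apply (continuity_pt_mult (fun s => s ^ p) h); [|apply Hh].
  apply derivable_continuous_pt, derivable_pt_pow. }
assert (Hex : forall a b, ex_RInt k a b).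
{ intros; apply (ex_RInt_continuous (V := R_CompleteNormedModule)); intros; apply Hk. }
assert (HE : forall s, 0 < s -> weighted_mean p h s = RInt k 0 s / s ^ S p).
{ intros s Hs.
  assert (Hc := RInt_comp_lin k s 0 0 1 (Hex _ _)).
  replace (s * 0 + 0) with 0 in Hc by ring.
  replace (s * 1 + 0) with s in Hc by ring.
  rewrite <- Hc.
  transitivity (s ^ S p * weighted_mean p h s / s ^ S p).
  { field; apply pow_nonzero; lra. }
  f_equal; symmetry; apply is_RInt_unique.
  apply (is_RInt_ext (fun x => s ^ S p * (x ^ p * h (s * x)))).
  - intros x _; unfold k, scal; simpl; unfold mult; simpl.
    rewrite Rplus_0_r, Rpow_mult_distr; ring.
  - apply (is_RInt_scal (fun x : R => x ^ p * h (s * x)) 0 1 (s ^ S p)).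
    apply (RInt_correct (V := R_CompleteNormedModule)).
    now apply ex_RInt_weighted. }
assert (Hpos : 0 < t ^ p) by now apply pow_lt.
apply (is_derive_ext_loc (fun s => RInt k 0 s / s ^ S p)).
{ exists (mkposreal t Ht); intros s Hs.
  symmetry; apply HE.
  apply Rabs_def2 in Hs; unfold minus, plus, opp in Hs; simpl in Hs; lra. }
assert (HR : is_derive (RInt k 0) t (k t)).
{ apply (is_derive_RInt k (RInt k 0) 0); [|apply Hk].
  apply filter_forall; intro s.
  apply (RInt_correct (V := R_CompleteNormedModule)), Hex. }
evar_last.
- apply (is_derive_div (RInt k 0)); [exact HR | |simpl; nra].
  apply (is_derive_pow (fun x => x)), is_derive_id.
- rewrite HE by exact Ht; unfold k, one; simpl pred; simpl pow; cbn -[INR pow].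
  field; split; lra.
Qed.

(** A fixed point of [u] mapped to the weighted mean of [F t (u t)] solves the equation. Averaging
    divides the Lipschitz constant [m] by [p + 1], so [m < S p] gives a contraction. *)
Lemma singular_ode_existence (F : R -> R -> R) (m p : nat) (B : R) :
  (m < S p)%nat ->
  (forall y, continuity y -> continuity (fun t => F t (y t))) ->
  (forall t x y, Rabs (F t x - F t y) <= INR m * Rabs (x - y)) ->
  (forall t, Rabs (F t 0) <= B) ->
  exists y, continuity y /\ INR (S p) * y 0 = F 0 (y 0) /\
    forall t, 0 < t -> is_derive y t ((F t (y t) - INR (S p) * y t) / t).
Proof.
intros Hmp Hc HL HB.
assert (Hp : 0 < INR (S p)) by (apply lt_0_INR; lia).
destruct (contraction_fixed_point (fun u => weighted_mean p (fun t => F t (u t)))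
  (B / INR (S p)) (INR m / INR (S p))) as [y [Hy Hfix]].
- split.
  + apply Rdiv_le_0_compat; [apply pos_INR | exact Hp].
  + apply Rlt_div_l; [exact Hp|]; rewrite Rmult_1_l; now apply lt_INR.
- intros u Hu; now apply weighted_mean_continuity, Hc.
- intros u v D Hu Hv HD t.
  replace (INR m / INR (S p) * D) with (INR m * D / INR (S p)) by (field; lra).
  apply weighted_mean_dist; [now apply Hc | now apply Hc |]; intros x _.
  eapply Rle_trans; [apply HL|].
  apply Rmult_le_compat_l; [apply pos_INR | apply HD].
- intro t.
  (* The mean of the zero function vanishes, so the bound is a distance between two means. *)
  replace (weighted_mean p (fun t => F t 0) t)
    with (weighted_mean p (fun t => F t 0) t - weighted_mean p (fun _ => 0) t)
    by (rewrite weighted_mean_const; unfold Rdiv; ring).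
  apply weighted_mean_dist.
  + apply (Hc (fun _ => 0)); intro; apply continuity_pt_const; now intros ? ?.
  + intro; apply continuity_pt_const; now intros ? ?.
  + intros x _; rewrite Rminus_0_r; apply HB.
- exists y; split; [exact Hy|]; split.
  + rewrite <- (Hfix 0) at 1; rewrite weighted_mean_0; field; lra.
  + intros t Ht.
    apply (is_derive_ext _ _ _ _ Hfix).
    rewrite <- (Hfix t) at 2.
    apply (is_derive_weighted_mean p (fun t => F t (y t))); [now apply Hc | exact Ht].
Qed.

(** * Functions of class C^k on a set *)

(** Finite-order counterpart of [smooth_on], asserting derivatives one level at a time so that
    proofs can go by induction on the order. *)
Fixpoint smooth_upto (D : R -> Prop) (k : nat) (f : R -> R) : Prop :=
  match k with
  | O => forall x, D x -> continue_in f D x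
  | S k => exists g, (forall x, D x -> D_in f g D x) /\ smooth_upto D k g
  end.

Lemma D_in_ext_on (D : R -> Prop) (f g h : R -> R) (x : R) :
  (forall y, D y -> f y = g y) -> D x -> D_in f h D x -> D_in g h D x.
Proof.
intros Hfg Hx; apply limit1_ext; intros y [Hy _].
now rewrite !Hfg.
Qed.

Lemma is_derive_D_in (D : R -> Prop) (f g : R -> R) (x l : R) :
  is_derive f x l -> l = g x -> D_in f g D x.
Proof.
intros Hf ->; apply is_derive_Reals, derivable_pt_lim_D_in in Hf.
now apply D_in_imp with (2 := Hf).
Qed.

Lemma D_in_is_derive (D : R -> Prop) (f g : R -> R) (x : R) :
  locally x D -> D_in f g D x -> is_derive f x (g x).
Proof.
intros [r Hr] Hf; apply is_derive_Reals, derivable_pt_lim_D_in.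
intros e He; destruct (Hf e He) as [d [Hd Hfd]].
exists (Rmin d r); split; [apply Rmin_pos; [exact Hd | apply cond_pos]|].
intros y [[_ Hy] Hyd]; apply Hfd; split; [split; [|exact Hy]|].
- apply Hr; exact (Rlt_le_trans _ _ _ Hyd (Rmin_r _ _)).
- exact (Rlt_le_trans _ _ _ Hyd (Rmin_l _ _)).
Qed.

Lemma smooth_upto_continue_in (D : R -> Prop) (k : nat) (f : R -> R) (x : R) :
  smooth_upto D k f -> D x -> continue_in f D x.
Proof.
destruct k as [|k]; [intros H Hx; exact (H x Hx)|].
intros [g [Hg _]] Hx; exact (cont_deriv f g D x (Hg x Hx)).
Qed.

Lemma smooth_upto_pred (D : R -> Prop) (k : nat) (f : R -> R) :
  smooth_upto D (S k) f -> smooth_upto D k f.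
Proof.
revert f; induction k as [|k IH]; intros f Hf.
- intros x; now apply (smooth_upto_continue_in D 1).
- destruct Hf as [g [Hfg Hg]]; exists g; auto.
Qed.

Lemma smooth_upto_ext (D : R -> Prop) (k : nat) (f g : R -> R) :
  (forall x, D x -> f x = g x) -> smooth_upto D k f -> smooth_upto D k g.
Proof.
intros Hfg; destruct k as [|k].
- intros Hf x Hx; unfold continue_in; rewrite <- Hfg by exact Hx.
  apply limit1_ext with (2 := Hf x Hx); intros y [Hy _]; auto.
- intros [h [Hfh Hh]]; exists h; split; [|exact Hh].
  intros x Hx; now apply (D_in_ext_on D f g), Hfh.
Qed.

Lemma smooth_upto_const (D : R -> Prop) (k : nat) (c : R) :
  smooth_upto D k (fun _ => c).
Proof.
revert c; induction k as [|k IH]; intro c.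
- intros x _; exact (cont_deriv _ _ _ _ (Dconst D c x)).
- exists (fun _ => 0); split; [intros; apply Dconst | apply IH].
Qed.

Lemma smooth_upto_id (D : R -> Prop) (k : nat) : smooth_upto D k (fun x => x).
Proof.
destruct k as [|k].
- intros x _; exact (cont_deriv _ _ _ _ (Dx D x)).
- exists (fun _ => 1); split; [intros; apply Dx | apply smooth_upto_const].
Qed.

Lemma smooth_upto_plus (D : R -> Prop) (k : nat) (f g : R -> R) :
  smooth_upto D k f -> smooth_upto D k g -> smooth_upto D k (fun x => f x + g x).
Proof.
revert f g; induction k as [|k IH]; intros f g Hf Hg.
- intros x Hx; apply limit_plus; [now apply Hf | now apply Hg].
- destruct Hf as [f' [Hff' Hf']], Hg as [g' [Hgg' Hg']].
  exists (fun x => f' x + g' x); split; [|now apply IH].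
  intros x Hx; apply Dadd; auto.
Qed.

Lemma smooth_upto_mult (D : R -> Prop) (k : nat) (f g : R -> R) :
  smooth_upto D k f -> smooth_upto D k g -> smooth_upto D k (fun x => f x * g x).
Proof.
revert f g; induction k as [|k IH]; intros f g Hf Hg.
- intros x Hx; apply limit_mul; [now apply Hf | now apply Hg].
- pose proof (smooth_upto_pred _ _ _ Hf); pose proof (smooth_upto_pred _ _ _ Hg).
  destruct Hf as [f' [Hff' Hf']], Hg as [g' [Hgg' Hg']].
  exists (fun x => f' x * g x + f x * g' x); split.
  + intros x Hx; apply Dmult; auto.
  + apply smooth_upto_plus; now apply IH.
Qed.

Lemma smooth_upto_minus (D : R -> Prop) (k : nat) (f g : R -> R) :
  smooth_upto D k f -> smooth_upto D k g -> smooth_upto D k (fun x => f x - g x).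
Proof.
intros Hf Hg.
apply (smooth_upto_ext D k (fun x => f x + (-1) * g x)); [intros; ring|].
apply smooth_upto_plus; [exact Hf|].
apply smooth_upto_mult; [apply smooth_upto_const | exact Hg].
Qed.

Lemma smooth_upto_pow (D : R -> Prop) (k j : nat) (f : R -> R) :
  smooth_upto D k f -> smooth_upto D k (fun x => f x ^ j).
Proof.
intro Hf; induction j as [|j IH]; simpl.
- apply smooth_upto_const.
- now apply smooth_upto_mult.
Qed.

(** The derivative is expressed through [f'] and powers of [/ sqrt (f t)] itself, which closes the
    induction on the order of smoothness. *)
Lemma D_in_inv_sqrt (D : R -> Prop) (f f' : R -> R) (x : R) :
  0 < f x -> D_in f f' D x ->
  D_in (fun t => / sqrt (f t)) (fun t => f' t * (- (1 / 2) * (/ sqrt (f t)) ^ 3)) D x.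
Proof.
intros Hx Hf.
apply (D_in_imp _ _ (Dgf D no_cond f)); [now split|].
apply (Dcomp D no_cond f' (fun u => - (1 / 2) * (/ sqrt u) ^ 3) f (fun u => / sqrt u));
  [exact Hf|].
assert (Hs : 0 < sqrt (f x)) by now apply sqrt_lt_R0.
eapply is_derive_D_in.
- apply is_derive_inv; [|lra].
  apply is_derive_Reals, derivable_pt_lim_sqrt; exact Hx.
- simpl; field; lra.
Qed.

Lemma continue_in_comp (D : R -> Prop) (f g : R -> R) (x : R) :
  continue_in f D x -> continuity_pt g (f x) -> continue_in (fun t => g (f t)) D x.
Proof.
intros Hf Hg e He.
destruct (Hg e He) as [d [Hd Hgd]], (Hf d Hd) as [r [Hr Hfr]].
exists r; split; [exact Hr|]; intros y Hy.
(* [continuity_pt] constrains [g] only at points different from [f x]. *)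
destruct (Req_dec (f x) (f y)) as [Heq|Hneq].
- rewrite Heq; simpl; unfold Rdist; now rewrite Rminus_diag, Rabs_R0.
- apply Hgd; split; [now split | now apply Hfr].
Qed.

Lemma smooth_upto_inv_sqrt (D : R -> Prop) (k : nat) (f : R -> R) :
  (forall x, D x -> 0 < f x) -> smooth_upto D k f ->
  smooth_upto D k (fun x => / sqrt (f x)).
Proof.
intro Hpos; revert f Hpos; induction k as [|k IH]; intros f Hpos Hf.
- intros x Hx.
  apply (continue_in_comp D f (fun u => / sqrt u)); [now apply Hf|].
  apply continuity_pt_inv.
  + apply continuity_pt_sqrt, Rlt_le, Hpos, Hx.
  + apply Rgt_not_eq, sqrt_lt_R0, Hpos, Hx.
- pose proof (smooth_upto_pred _ _ _ Hf) as Hfk.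
  destruct Hf as [f' [Hff' Hf']].
  exists (fun x => f' x * (- (1 / 2) * (/ sqrt (f x)) ^ 3)); split.
  + intros x Hx; apply D_in_inv_sqrt; auto.
  + apply smooth_upto_mult; [exact Hf'|].
    apply smooth_upto_mult; [apply smooth_upto_const|].
    apply smooth_upto_pow; auto.
Qed.

Lemma smooth_upto_subset (D E : R -> Prop) (k : nat) (f : R -> R) :
  (forall x, E x -> D x) -> smooth_upto D k f -> smooth_upto E k f.
Proof.
intro HED; revert f; induction k as [|k IH]; intros f Hf.
- intros x Hx; apply (limit1_imp _ (D_x D x)); [|now apply Hf, HED].
  intros y [Hy Hyx]; split; auto.
- destruct Hf as [g [Hfg Hg]]; exists g; split; [|now apply IH].
  intros x Hx; apply (D_in_imp _ _ D); auto.
Qed.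

Lemma smooth_on_smooth_upto (D : R -> Prop) (f : R -> R) (k : nat) :
  smooth_on D f -> smooth_upto D k f.
Proof.
intros [d [Hd0 Hd]].
apply (smooth_upto_ext D k (d 0%nat)); [exact Hd0|].
generalize 0%nat as j; induction k as [|k IH]; intro j.
- intros x Hx; exact (cont_deriv _ _ _ _ (Hd j x Hx)).
- exists (d (S j)); auto.
Qed.

Lemma D_in_unique (D : R -> Prop) (f g h : R -> R) (x : R) :
  adhDa (D_x D x) x -> D_in f g D x -> D_in f h D x -> g x = h x.
Proof. intro HD; now apply single_limit. Qed.

(** Each order may supply its own first derivative, but on a set without isolated points they all
    agree. Hence one derivative is again of every finite order, and choice builds the whole
    sequence. *)
Lemma smooth_upto_smooth_on (D : R -> Prop) (f : R -> R) :
  (forall x, D x -> adhDa (D_x D x) x) ->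
  (forall k, smooth_upto D k f) -> smooth_on D f.
Proof.
intros HD Hf.
assert (Hstep : forall u : {u | forall k, smooth_upto D k u},
  {v : {v | forall k, smooth_upto D k v} |
    forall x, D x -> D_in (proj1_sig u) (proj1_sig v) D x}).
{ intros [u Hu]; apply constructive_indefinite_description.
  destruct (Hu 1%nat) as [v [Hv _]].
  assert (Hvs : forall k, smooth_upto D k v).
  { intro k; destruct (Hu (S k)) as [v' [Hv' Hk]].
    apply (smooth_upto_ext D k v'); [|exact Hk].
    intros x Hx; apply (D_in_unique D u); auto. }
  now exists (exist _ v Hvs). }
set (d := fix d (k : nat) := match k with
  | O => exist _ f Hf | S k => proj1_sig (Hstep (d k)) end).
exists (fun k => proj1_sig (d k)); split; [reflexivity|].
intros k x Hx; exact (proj2_sig (Hstep (d k)) x Hx).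
Qed.

(** * Regularity of singular linear equations *)

(** A positive value at [t] would exceed the value at some [s < t] close to 0, against the mean
    value theorem. Only the limit at 0 enters, so [f] may be singular there. *)
Lemma nonpos_of_derive_nonpos (f f' : R -> R) (eps : R) :
  (forall t, 0 < t < eps -> is_derive f t (f' t)) ->
  (forall t, 0 < t < eps -> f' t <= 0) ->
  limit1_in f (fun t => 0 < t < eps) 0 0 ->
  forall t, 0 < t < eps -> f t <= 0.
Proof.
intros Hf Hf' Hlim t Ht; apply Rnot_lt_le; intro Hpos.
destruct (Hlim (f t) Hpos) as [d [Hd Hfd]].
set (s := Rmin d t / 2).
assert (Hs : 0 < s < t /\ s < d).
{ assert (0 < Rmin d t) by (apply Rmin_pos; lra).
  generalize (Rmin_l d t) (Rmin_r d t); unfold s; lra. }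
assert (Hfs : Rabs (f s) < f t).
{ specialize (Hfd s); simpl in Hfd; unfold Rdist in Hfd.
  rewrite !Rminus_0_r, (Rabs_pos_eq s) in Hfd by lra.
  apply Hfd; lra. }
destruct (MVT_cor2 f f' s t) as [c [Hc Hcst]]; [lra | |].
- intros c Hc; apply is_derive_Reals, Hf; lra.
- assert (f' c <= 0) by (apply Hf'; lra).
  apply Rabs_def2 in Hfs; nra.
Qed.

Lemma limit1_in_locally (f : R -> R) (eps l e : R) :
  0 < eps -> 0 < e -> limit1_in f (fun t => 0 < t < eps) l 0 ->
  exists d, 0 < d <= eps /\ forall t, 0 < t < d -> Rabs (f t - l) < e.
Proof.
intros Heps He Hf; destruct (Hf e He) as [d [Hd Hfd]].
exists (Rmin d eps); split; [split; [now apply Rmin_pos | apply Rmin_r]|].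
intros t Ht; generalize (Rmin_l d eps) (Rmin_r d eps); intros.
apply Hfd; simpl; unfold Rdist; rewrite Rminus_0_r, Rabs_pos_eq; lra.
Qed.

Lemma limit1_in_eq (f : R -> R) (D : R -> Prop) (l l' x : R) :
  limit1_in f D l x -> l = l' -> limit1_in f D l' x.
Proof. now intros Hf <-. Qed.

Lemma limit1_in_const (D : R -> Prop) (c x : R) : limit1_in (fun _ => c) D c x.
Proof. exact (limit_free (fun _ => c) D x x). Qed.

(* With [z = p - L], [L = - B0 / A0], the equation bounds the derivative of
   [(t z)^2] by [mu eta^2 t]; the hypothesis [t p -> 0] fixes the integration
   constant and excludes the homogeneous solutions, which grow like [t ^ A0]. *)
Lemma singular_linear_limit (A B p : R -> R) (A0 B0 eps : R) :
  0 < eps -> A0 < -1 ->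
  limit1_in A (fun t => 0 < t < eps) A0 0 ->
  limit1_in B (fun t => 0 < t < eps) B0 0 ->
  limit1_in (fun t => t * p t) (fun t => 0 < t < eps) 0 0 ->
  (forall t, 0 < t < eps -> is_derive p t ((A t * p t + B t) / t)) ->
  limit1_in p (fun t => 0 < t < eps) (- B0 / A0) 0.
Proof.
intros Heps HA0 HA HB Htp Hp eta Heta.
set (L := - B0 / A0).
(* Within [mu] of [A0], [A t + 1] is below [- mu]; [mu <= 1] serves the final comparison with
   [eta]. *)
set (mu := Rmin ((-1 - A0) / 2) 1).
assert (Hmu : 0 < mu <= 1 /\ 2 * mu <= -1 - A0).
{ generalize (Rmin_l ((-1 - A0) / 2) 1) (Rmin_r ((-1 - A0) / 2) 1); intros.
  assert (0 < mu) by (apply Rmin_pos; lra); unfold mu in *; lra. }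
destruct (limit1_in_locally A eps A0 mu Heps) as [d1 [Hd1 HAd]]; [lra | exact HA |].
destruct (limit1_in_locally (fun t => A t * L + B t) eps 0 (mu * eta) Heps)
  as [d2 [Hd2 HBd]]; [nra | |].
{ apply (limit1_in_eq _ _ (A0 * L + B0)); [|unfold L; field; lra].
  apply limit_plus; [|exact HB].
  apply limit_mul; [exact HA | apply limit1_in_const]. }
set (d := Rmin d1 d2).
assert (Hd : 0 < d /\ d <= d1 /\ d <= d2).
{ split; [apply Rmin_pos; lra | split; [apply Rmin_l | apply Rmin_r]]. }
set (z := fun t => p t - L).
assert (HW : forall t, 0 < t < d -> (t * z t) ^ 2 - mu * eta ^ 2 / 2 * t ^ 2 <= 0).
{ apply (nonpos_of_derive_nonpos
    (fun t => (t * z t) ^ 2 - mu * eta ^ 2 / 2 * t ^ 2)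
    (fun t => 2 * (t * z t) * (z t + (A t * p t + B t)) - mu * eta ^ 2 * t)).
  - intros t Ht; assert (Hpt := Hp t ltac:(lra)).
    unfold z; auto_derive; [now exists ((A t * p t + B t) / t)|].
    replace (Derive _ t) with ((A t * p t + B t) / t)
      by (symmetry; now apply is_derive_unique).
    field; lra.
  - intros t Ht.
    specialize (HAd t ltac:(lra)); specialize (HBd t ltac:(lra)).
    apply Rabs_def2 in HAd; rewrite Rminus_0_r in HBd; apply Rabs_def2 in HBd.
    replace (z t + (A t * p t + B t))
      with ((A t + 1) * z t + (A t * L + B t)) by (unfold z; ring).
    set (be := A t * L + B t) in *; set (y := z t).
    assert (H1 : (A t + 1) * y ^ 2 <= - mu * y ^ 2).
    { apply Rmult_le_compat_r; [apply pow2_ge_0 | lra]. }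
    (* Young's inequality, from [Rabs be <= mu * eta]; half of the damping term [- 2 * mu * y ^ 2]
       absorbs the [y ^ 2] part. *)
    assert (H2 : y * be <= mu * (y ^ 2 + eta ^ 2) / 2).
    { assert (y * be <= Rabs y * (mu * eta)).
      { eapply Rle_trans; [apply Rle_abs|]; rewrite Rabs_mult.
        apply Rmult_le_compat_l; [apply Rabs_pos | apply Rabs_le; lra]. }
      assert (0 <= mu * (Rabs y - eta) ^ 2)
        by (apply Rmult_le_pos; [lra | apply pow2_ge_0]).
      rewrite <- (pow2_abs y); nra. }
    assert (0 <= mu * y ^ 2) by (apply Rmult_le_pos; [lra | apply pow2_ge_0]).
    replace (2 * (t * y) * ((A t + 1) * y + be) - mu * eta ^ 2 * t)
      with (t * (2 * ((A t + 1) * y ^ 2 + y * be) - mu * eta ^ 2)) by ring.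
    apply Ropp_le_cancel; rewrite Ropp_0, Ropp_mult_distr_r.
    apply Rmult_le_pos; lra.
  - apply (limit1_ext (fun t => (t * p t - L * t) * (t * p t - L * t)
      - mu * eta ^ 2 / 2 * (t * t))); [intros; unfold z; ring|].
    apply (limit1_imp _ (fun t => 0 < t < eps)); [simpl; intros; lra|].
    assert (Hid := lim_x (fun t => 0 < t < eps) 0).
    apply (limit1_in_eq _ _ ((0 - L * 0) * (0 - L * 0) - mu * eta ^ 2 / 2 * (0 * 0)));
      [|ring].
    repeat first [apply limit_minus | apply limit_mul | exact Htp | exact Hid
      | apply limit1_in_const]. }
exists d; split; [lra|]; intros t [Ht Htd].
simpl in *; unfold Rdist in *; rewrite Rminus_0_r, Rabs_pos_eq in Htd by lra.
specialize (HW t ltac:(lra)); fold L; change (p t - L) with (z t).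
assert (0 < t ^ 2) by (apply pow_lt; lra).
assert (Hz : Rabs (z t) ^ 2 <= mu * eta ^ 2 / 2) by (rewrite pow2_abs; nra).
apply Rnot_le_lt; intro Hge.
assert (eta ^ 2 <= Rabs (z t) ^ 2) by (apply pow_incr; lra).
assert (0 < eta ^ 2) by (apply pow_lt; lra).
nra.
Qed.

(** The error [f t - f 0 - g 0 * t] has derivative [g t - g 0], which is small near 0. The sign
    lemma, applied to the error and its negative minus [e / 2 * t], bounds the difference
    quotient. *)
Lemma D_in_endpoint (f g : R -> R) (eps : R) :
  0 < eps ->
  continue_in f (initial_interval eps) 0 -> continue_in g (initial_interval eps) 0 ->
  (forall t, 0 < t < eps -> is_derive f t (g t)) ->
  D_in f g (initial_interval eps) 0.
Proof.
intros Heps Hf Hg Hfg e He.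
assert (Hsub : forall t, 0 < t < eps -> D_x (initial_interval eps) 0 t)
  by (intros t Ht; split; [split; lra | lra]).
destruct (limit1_in_locally g eps (g 0) (e / 2) Heps) as [d [Hd Hgd]];
  [lra | now apply limit1_imp with (2 := Hg) |].
assert (Hbound : forall s, s = 1 \/ s = -1 ->
  forall t, 0 < t < d -> s * (f t - f 0 - g 0 * t) - e / 2 * t <= 0).
{ intros s Hs.
  apply (nonpos_of_derive_nonpos (fun t => s * (f t - f 0 - g 0 * t) - e / 2 * t)
    (fun t => s * (g t - g 0) - e / 2)).
  - intros t Ht; assert (Hft := Hfg t ltac:(lra)).
    auto_derive; [now exists (g t)|].
    replace (Derive _ t) with (g t) by (symmetry; now apply is_derive_unique).
    ring.
  - intros t Ht; specialize (Hgd t Ht); apply Rabs_def2 in Hgd.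
    destruct Hs as [-> | ->]; lra.
  - apply (limit1_in_eq _ _ (s * (f 0 - f 0 - g 0 * 0) - e / 2 * 0)); [|ring].
    assert (Hid := lim_x (fun t => 0 < t < d) 0).
    assert (Hf0 : limit1_in f (fun t => 0 < t < d) (f 0) 0).
    { apply limit1_imp with (2 := Hf); intros; apply Hsub; lra. }
    repeat first [exact Hf0 | exact Hid | apply limit_minus | apply limit_mul
      | apply limit1_in_const]. }
exists d; split; [lra|]; intros t [[[Ht0 Hte] Htn] Htd].
simpl in *; unfold Rdist in *; rewrite Rminus_0_r in *.
rewrite Rabs_pos_eq in Htd by lra.
assert (H1 := Hbound 1 (or_introl eq_refl) t ltac:(lra)).
assert (H2 := Hbound (-1) (or_intror eq_refl) t ltac:(lra)).
apply Rle_lt_trans with (e / 2); [|lra].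
replace ((f t - f 0) / t - g 0) with ((f t - f 0 - g 0 * t) / t) by (field; lra).
rewrite Rabs_div, (Rabs_pos_eq t) by lra.
apply Rle_div_l; [lra|]; apply Rabs_le; lra.
Qed.

Lemma initial_interval_interior (eps t : R) :
  0 < t < eps -> locally t (initial_interval eps).
Proof.
intro Ht; assert (Hr : 0 < Rmin t (eps - t)) by (apply Rmin_pos; lra).
exists (mkposreal _ Hr); intros s Hs; simpl in Hs.
apply Rabs_def2 in Hs; unfold minus, plus, opp in Hs; simpl in Hs.
generalize (Rmin_l t (eps - t)) (Rmin_r t (eps - t)); split; lra.
Qed.

Lemma initial_interval_adherent (eps t : R) :
  initial_interval eps t ->
  adhDa (D_x (initial_interval eps) t) t.
Proof.
intros Ht a Ha; set (r := Rmin a (eps - t)).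
assert (Hr : 0 < r <= a /\ r <= eps - t).
{ unfold initial_interval in Ht; split; [split|]; [apply Rmin_pos; lra| |];
    [apply Rmin_l | apply Rmin_r]. }
exists (t + r / 2); unfold initial_interval in *; split.
- split; lra.
- unfold Rdist; replace (t + r / 2 - t) with (r / 2) by ring.
  rewrite Rabs_pos_eq; lra.
Qed.

(* Differentiating [t p' = A p + B] gives [t q' = (A - 1) q + (A' p + B')] for
   [q = p'], an equation of the same kind with [k] lowered by one. *)
Lemma singular_linear_smooth (eps : R) (k : nat) (A B p : R -> R) :
  0 < eps -> A 0 < -1 ->
  smooth_upto (initial_interval eps) k A -> smooth_upto (initial_interval eps) k B ->
  limit1_in (fun t => t * p t) (fun t => 0 < t < eps) 0 0 ->
  (forall t, 0 < t < eps -> is_derive p t ((A t * p t + B t) / t)) ->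
  exists P, smooth_upto (initial_interval eps) k P /\
    forall t, 0 < t < eps -> P t = p t.
Proof.
intro Heps.
assert (H0 : initial_interval eps 0) by (split; lra).
assert (Hlim : forall j f, smooth_upto (initial_interval eps) j f ->
  limit1_in f (fun t => 0 < t < eps) (f 0) 0).
{ intros j f Hf.
  apply limit1_imp with (2 := smooth_upto_continue_in _ j f 0 Hf H0).
  intros t Ht; split; [split|]; lra. }
revert A B p; induction k as [|k IH]; intros A B p HA0 HA HB Htp Hp.
- assert (Hl := singular_linear_limit A B p _ _ eps Heps HA0
    (Hlim _ _ HA) (Hlim _ _ HB) Htp Hp).
  (* The value at 0 is the limit of [p], which makes the extension continuous. *)
  set (P := fun t => if Rle_dec t 0 then - B 0 / A 0 else p t).
  assert (HP : forall t, 0 < t -> P t = p t).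
  { intros t Ht; unfold P; destruct (Rle_dec t 0); [lra | reflexivity]. }
  exists P; split; [|intros; apply HP; lra].
  intros x Hx; destruct (Req_dec x 0) as [->|Hx0].
  + unfold continue_in; replace (P 0) with (- B 0 / A 0)
      by (unfold P; destruct (Rle_dec 0 0); lra).
    apply (limit1_imp _ (fun t => 0 < t < eps)).
    { intros t [[? ?] ?]; lra. }
    apply limit1_ext with (2 := Hl); intros t Ht; symmetry; apply HP; lra.
  + assert (Hx' : 0 < x < eps) by (unfold initial_interval in Hx; lra).
    apply (cont_deriv _ (fun t => (A t * p t + B t) / t)).
    apply (is_derive_D_in _ _ _ _ ((A x * p x + B x) / x)); [|reflexivity].
    apply (is_derive_ext_loc p); [|now apply Hp].
    apply (locally_open (fun t => 0 < t)); [apply open_gt | | apply Hx'].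
    intros t Ht; symmetry; now apply HP.
- assert (HAk := smooth_upto_pred _ _ _ HA); assert (HBk := smooth_upto_pred _ _ _ HB).
  assert (Hl := singular_linear_limit A B p _ _ eps Heps HA0
    (Hlim _ _ HA) (Hlim _ _ HB) Htp Hp).
  destruct (IH A B p HA0 HAk HBk Htp Hp) as [P [HP HPp]].
  destruct HA as [A' [HAA' HA']], HB as [B' [HBB' HB']].
  set (q := fun t => (A t * p t + B t) / t).
  (* The coefficient uses the extension [P], already of class C^k up to 0, in place of [p]. *)
  destruct (IH (fun t => A t - 1) (fun t => A' t * P t + B' t) q) as [Q [HQ HQq]].
  + lra.
  + apply smooth_upto_minus; [exact HAk | apply smooth_upto_const].
  + apply smooth_upto_plus; [apply smooth_upto_mult|]; assumption.
  (* [t * q t] is [A t * p t + B t], which tends to 0 because [p] tends to [- B 0 / A 0]. *)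
  + apply (limit1_ext (fun t => A t * p t + B t)); [intros t Ht; unfold q; field; lra|].
    apply (limit1_in_eq _ _ (A 0 * (- B 0 / A 0) + B 0)); [|field; lra].
    apply limit_plus; [apply limit_mul|]; [| exact Hl |]; eapply Hlim; eassumption.
  + intros t Ht; rewrite HPp by exact Ht.
    assert (Hpt := Hp t Ht).
    assert (Hin := initial_interval_interior eps t Ht).
    assert (HAt := D_in_is_derive _ _ _ _ Hin (HAA' t (locally_singleton _ _ Hin))).
    assert (HBt := D_in_is_derive _ _ _ _ Hin (HBB' t (locally_singleton _ _ Hin))).
    unfold q; auto_derive.
    * repeat split; [now exists (A' t) | | now exists (B' t) | lra].
      now exists ((A t * p t + B t) / t).
    * apply is_derive_unique in HAt, HBt, Hpt.
      change (fun x => A x) with A; change (fun x => B x) with B;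
      change (fun x => p x) with p.
      rewrite HAt, HBt, Hpt; field; lra.
  + exists P; split; [|intros; now apply HPp].
    assert (HPQ : forall t, 0 < t < eps -> is_derive P t (Q t)).
    { intros t Ht; rewrite HQq by exact Ht.
      apply (is_derive_ext_loc p); [|now apply Hp].
      apply (locally_open (fun t => 0 < t /\ t < eps));
        [apply open_and; [apply open_gt | apply open_lt] | | exact Ht].
      intros s Hs; symmetry; now apply HPp. }
    exists Q; split; [|exact HQ].
    intros x Hx; destruct (Req_dec x 0) as [->|Hx0].
    * apply D_in_endpoint; [exact Heps | | | exact HPQ].
      -- now apply (smooth_upto_continue_in _ k).
      -- now apply (smooth_upto_continue_in _ k).
    * apply (is_derive_D_in _ _ _ _ (Q x)); [|reflexivity].
      apply HPQ; unfold initial_interval in Hx; lra.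
Qed.

(** * The reduced equation *)

Definition clamp (lo hi x : R) : R := Rmax lo (Rmin x hi).

Lemma clamp_bounds (lo hi x : R) : lo <= hi -> lo <= clamp lo hi x <= hi.
Proof.
intro H; unfold clamp; split; [apply Rmax_l|].
apply Rmax_lub; [exact H | apply Rmin_r].
Qed.

Lemma clamp_id (lo hi x : R) : lo <= x <= hi -> clamp lo hi x = x.
Proof. intros [H1 H2]; unfold clamp; now rewrite Rmin_left, Rmax_right. Qed.

Lemma clamp_dist (lo hi x y : R) :
  Rabs (clamp lo hi x - clamp lo hi y) <= Rabs (x - y).
Proof.
unfold clamp, Rmax, Rmin.
destruct (Rle_dec x hi), (Rle_dec y hi);
  repeat (match goal with |- context [Rle_dec lo ?z] => destruct (Rle_dec lo z) end);
  split_Rabs; lra.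
Qed.

Lemma clamp_continuity (lo hi : R) : continuity (clamp lo hi).
Proof.
intros x e He; exists e; split; [exact He|]; intros y [_ Hy].
eapply Rle_lt_trans; [apply clamp_dist | exact Hy].
Qed.

(** Clamping keeps the argument in the half line, turning one-sided continuity there into continuity
    on all of R. *)
Lemma continuity_comp_clamp (f : R -> R) (hi : R) :
  0 <= hi -> (forall t, half_line t -> continue_in f half_line t) ->
  continuity (fun t => f (clamp 0 hi t)).
Proof.
intros Hhi Hf t e He.
assert (Hc : half_line (clamp 0 hi t)) by now apply clamp_bounds.
destruct (Hf _ Hc e He) as [d [Hd Hfd]].
exists d; split; [exact Hd|]; intros s [_ Hs].
destruct (Req_dec (clamp 0 hi t) (clamp 0 hi s)) as [Heq|Hneq].
- rewrite Heq; simpl; unfold Rdist; now rewrite Rminus_diag, Rabs_R0.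
- apply Hfd; split; [split; [now apply clamp_bounds | congruence]|].
  eapply Rle_lt_trans; [apply clamp_dist | exact Hs].
Qed.

Lemma continue_in_half_line_0 (f : R -> R) (e : R) :
  continue_in f half_line 0 -> 0 < e ->
  exists d, 0 < d /\ forall t, 0 <= t <= d -> Rabs (f t - f 0) <= e.
Proof.
intros Hf He; destruct (Hf e He) as [d [Hd Hfd]].
exists (d / 2); split; [lra|]; intros t Ht.
destruct (Req_dec t 0) as [->|Ht0].
- rewrite Rminus_diag, Rabs_R0; lra.
- apply Rlt_le, (Hfd t); split; [split; [apply Ht | auto]|].
  simpl; unfold Rdist; rewrite Rminus_0_r, Rabs_pos_eq; lra.
Qed.

(** With [w = c t^2 y], [phi = c f], [psi = c g], the right-hand side of the original equation is
    [c^2 t^2] times this quantity. *)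
Definition radicand (a c : R) (f g : R -> R) (t y : R) : R :=
  a * f t * (c * t ^ 2 * y ^ 2 - 2 * y) + (1 - a) * (f t * g t).

(** At [t = 0] the radicand is [b - 2 a x], equal to [b^2] at [x = b/2]. Over the box, varying [x]
    costs at most [b^2/4] and the perturbations in [t] another [b^2/4], leaving at least [b^2/2]. *)
Lemma radicand_box (a c : R) (f g : R -> R) (t x : R) :
  let b := 1 - a in
  0 <= a < 1 ->
  Rabs (c * t ^ 2) <= b ^ 2 / 16 -> Rabs (f t - 1) <= b ^ 2 / 32 ->
  Rabs (f t * g t - 1) <= b ^ 2 / 16 ->
  b / 2 - b ^ 2 / 8 <= x <= b / 2 + b ^ 2 / 8 ->
  (b / 2) ^ 2 <= radicand a c f g t x <= 4.
Proof.
intros b Ha Hc Hf Hfg Hx; unfold radicand.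
replace (1 - a) with b by reflexivity.
assert (Hb : 0 < b <= 1) by (unfold b; lra).
apply Rabs_le_between in Hc, Hf, Hfg.
set (C := c * t ^ 2) in *; set (F := f t) in *; set (G := F * g t) in *.
assert (Hbb : 0 < b ^ 2 <= b) by nra.
assert (Hx1 : 0 <= x <= 1) by nra.
assert (Hx2 : 0 <= x ^ 2 <= 1) by nra.
assert (HF : 0 <= F <= 2) by lra.
assert (HaF : 0 <= a * F <= 2) by nra.
assert (HC : - (b ^ 2 / 16) <= C * x ^ 2 <= b ^ 2 / 16) by nra.
assert (HaFC : - (b ^ 2 / 8) <= a * F * (C * x ^ 2) <= b ^ 2 / 8) by nra.
assert (Hax : 0 <= a * x <= 1) by nra.
assert (HaFx : - (b ^ 2 / 32) <= a * x * (F - 1) <= b ^ 2 / 32) by nra.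
assert (HbG : - (b ^ 2 / 16) <= b * (G - 1) <= b ^ 2 / 16) by nra.
replace (a * F * (C * x ^ 2 - 2 * x) + b * G) with
  (a * F * (C * x ^ 2) - 2 * (a * x * (F - 1)) + b * (G - 1) + (b - 2 * (a * x))) by ring.
assert (Hax' : a * x <= a * (b / 2 + b ^ 2 / 8)) by (apply Rmult_le_compat_l; lra).
assert (Hab : a * b = b - b ^ 2) by (unfold b; ring).
assert (Hab2 : a * b ^ 2 <= b ^ 2) by nra.
split; nra.
Qed.

(** Rationalising the difference of roots gives slope [- N / (X + Y)] with [0 <= N <= 8] and
    [X + Y >= b], hence a slope in [[-8/b, 0]]. Adding [m >= 8/b] moves it into [[0, m]]. *)
Lemma sqrt_radicand_lipschitz (a c : R) (f g : R -> R) (t x y : R) (m : R) :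
  let b := 1 - a in
  0 <= a < 1 -> 8 / b <= m ->
  Rabs (c * t ^ 2) <= b ^ 2 / 16 -> Rabs (f t - 1) <= b ^ 2 / 32 ->
  Rabs (f t * g t - 1) <= b ^ 2 / 16 ->
  b / 2 - b ^ 2 / 8 <= x <= b / 2 + b ^ 2 / 8 ->
  b / 2 - b ^ 2 / 8 <= y <= b / 2 + b ^ 2 / 8 ->
  Rabs ((sqrt (radicand a c f g t x) + m * x) - (sqrt (radicand a c f g t y) + m * y))
    <= m * Rabs (x - y).
Proof.
intros b Ha Hm Hc Hf Hfg Hx Hy.
assert (Hb : 0 < b <= 1) by (unfold b; lra).
destruct (radicand_box a c f g t x Ha Hc Hf Hfg Hx) as [HEx _].
destruct (radicand_box a c f g t y Ha Hc Hf Hfg Hy) as [HEy _].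
fold b in HEx, HEy.
assert (Hsq : forall E, (b / 2) ^ 2 <= E -> b / 2 <= sqrt E /\ sqrt E * sqrt E = E).
{ intros E HE; split.
  - rewrite <- (sqrt_pow2 (b / 2)) by lra; now apply sqrt_le_1_alt.
  - apply sqrt_sqrt; nra. }
destruct (Hsq _ HEx) as [HX HX2], (Hsq _ HEy) as [HY HY2].
set (X := sqrt (radicand a c f g t x)) in *.
set (Y := sqrt (radicand a c f g t y)) in *.
set (N := a * f t * (2 - c * t ^ 2 * (x + y))).
apply Rabs_le_between in Hc, Hf.
assert (HN : 0 <= N <= 8).
{ assert (0 < b ^ 2 <= b) by nra.
  assert (0 <= a * f t <= 2) by nra.
  assert (0 <= x + y <= 2) by lra.
  assert (-1 <= c * t ^ 2 * (x + y) <= 1) by nra.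
  unfold N; nra. }
assert (HXY : X - Y = - (N / (X + Y)) * (x - y)).
{ apply (Rmult_eq_reg_r (X + Y)); [|lra].
  replace ((X - Y) * (X + Y)) with (X * X - Y * Y) by ring.
  rewrite HX2, HY2; unfold radicand, N; field; lra. }
assert (HQ : 0 <= N / (X + Y) <= m).
{ split; [apply Rdiv_le_0_compat; lra|].
  apply Rle_div_l; [lra|].
  apply Rle_div_l in Hm; [|lra]; nra. }
replace (X + m * x - (Y + m * y)) with ((m - N / (X + Y)) * (x - y))
  by (replace (X + m * x - (Y + m * y)) with ((X - Y) + m * (x - y)) by ring;
      rewrite HXY; ring).
rewrite Rabs_mult; apply Rmult_le_compat_r; [apply Rabs_pos|].
apply Rabs_le; lra.
Qed.

(* Adding [m y] to both sides of [t y' + 2 y = sqrt (...)] with [m] large makes the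
   right-hand side, whose square root decreases in [y], [m]-Lipschitz, while the
   left-hand side becomes [t y' + (m + 2) y].  Clamping [t] and [y] to a box on which
   the radicand is positive makes the Lipschitz bound global. *)
Lemma reduced_equation_existence (a c : R) (f g : R -> R) :
  0 <= a < 1 -> f 0 = 1 -> g 0 = 1 ->
  (forall t, half_line t -> continue_in f half_line t) ->
  (forall t, half_line t -> continue_in g half_line t) ->
  exists eps y, 0 < eps /\ continuity y /\ y 0 = (1 - a) / 2 /\
    (forall t, 0 <= t < eps -> 0 < radicand a c f g t (y t)) /\
    (forall t, 0 < t < eps ->
       is_derive y t ((sqrt (radicand a c f g t (y t)) - 2 * y t) / t)).
Proof.
intros Ha Hf0 Hg0 Hf Hg.
set (b := 1 - a); assert (Hb : 0 < b <= 1) by (unfold b; lra).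
assert (Hb2 : 0 < b ^ 2 <= b) by nra.
assert (H0 : half_line 0) by apply Rle_refl.
destruct (continue_in_half_line_0 f (b ^ 2 / 32) (Hf 0 H0)) as [d1 [Hd1 Hfd]]; [lra|].
destruct (continue_in_half_line_0 (fun t => f t * g t) (b ^ 2 / 16)) as [d2 [Hd2 Hfgd]];
  [apply limit_mul; [now apply Hf | now apply Hg] | lra |].
destruct (continue_in_half_line_0 (fun t => c * t ^ 2) (b ^ 2 / 16)) as [d3 [Hd3 Hcd]];
  [|lra|].
{ refine (smooth_upto_continue_in half_line 0 _ 0 _ H0).
  apply smooth_upto_mult; [apply smooth_upto_const|].
  apply smooth_upto_pow, smooth_upto_id. }
set (tau := Rmin d1 (Rmin d2 d3)).
assert (Htau : 0 < tau /\ tau <= d1 /\ tau <= d2 /\ tau <= d3).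
{ generalize (Rmin_l d1 (Rmin d2 d3)) (Rmin_r d1 (Rmin d2 d3))
    (Rmin_l d2 d3) (Rmin_r d2 d3); fold tau; intros.
  split; [repeat apply Rmin_pos; lra | lra]. }
assert (Hbox : forall t, 0 <= t <= tau -> Rabs (c * t ^ 2) <= b ^ 2 / 16 /\
  Rabs (f t - 1) <= b ^ 2 / 32 /\ Rabs (f t * g t - 1) <= b ^ 2 / 16).
{ intros t Ht.
  specialize (Hfd t ltac:(lra)); specialize (Hfgd t ltac:(lra)); specialize (Hcd t ltac:(lra)).
  rewrite Hf0 in Hfd; rewrite Hf0, Hg0, Rmult_1_r in Hfgd.
  replace (c * t ^ 2 - c * 0 ^ 2) with (c * t ^ 2) in Hcd by ring; auto. }
set (lo := b / 2 - b ^ 2 / 8); set (hi := b / 2 + b ^ 2 / 8).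
assert (Hlohi : lo <= hi) by (unfold lo, hi; lra).
(* An integer [m], since it also fixes the exponent [S m] of the weight. *)
destruct (INR_unbounded (8 / b)) as [m Hm].
set (s := fun t => clamp 0 tau t); set (k := fun y => clamp lo hi y).
assert (Hs : forall t, 0 <= s t <= tau) by (intro; apply clamp_bounds; lra).
assert (Hk : forall y, lo <= k y <= hi) by (intro; now apply clamp_bounds).
set (F := fun t y => sqrt (radicand a c f g (s t) (k y)) + INR m * k y).
assert (HL : forall t x y, Rabs (F t x - F t y) <= INR m * Rabs (x - y)).
{ intros t x y; destruct (Hbox (s t) (Hs t)) as [H1 [H2 H3]].
  apply Rle_trans with (INR m * Rabs (k x - k y)).
  - unfold F; apply sqrt_radicand_lipschitz; auto; apply Rlt_le, Hm.
  - apply Rmult_le_compat_l; [apply pos_INR | apply clamp_dist]. }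
destruct (singular_ode_existence F m (S m) (2 + INR m)) as [y [Hyc [Hy0 Hy]]].
- lia.
- intros y Hy.
  assert (Hfs := continuity_comp_clamp f tau (Rlt_le _ _ (proj1 Htau)) Hf).
  assert (Hgs := continuity_comp_clamp g tau (Rlt_le _ _ (proj1 Htau)) Hg).
  assert (Hss := clamp_continuity 0 tau).
  assert (Hks := continuity_comp _ _ Hy (clamp_continuity lo hi)).
  unfold F, radicand, s, k; unfold comp in Hks.
  set (fs := fun t => f (clamp 0 tau t)) in *.
  set (gs := fun t => g (clamp 0 tau t)) in *.
  set (ys := fun t => clamp lo hi (y t)) in *.
  set (ss := clamp 0 tau) in *.
  intro t; apply (continuity_pt_plus (fun t => sqrt (a * fs t * (c * ss t ^ 2 * ys t ^ 2
    - 2 * ys t) + (1 - a) * (fs t * gs t))) (fun t => INR m * ys t)); [|reg].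
  apply (continuity_pt_comp (fun t => a * fs t * (c * ss t ^ 2 * ys t ^ 2
    - 2 * ys t) + (1 - a) * (fs t * gs t)) sqrt); [reg|].
  apply continuity_pt_sqrt.
  destruct (Hbox (s t) (Hs t)) as [H1 [H2 H3]].
  destruct (radicand_box a c f g (s t) (k (y t)) Ha H1 H2 H3 (Hk (y t))) as [H4 _].
  eapply Rle_trans; [apply pow2_ge_0 | exact H4].
- exact HL.
- intro t; destruct (Hbox (s t) (Hs t)) as [H1 [H2 H3]].
  destruct (radicand_box a c f g (s t) (k 0) Ha H1 H2 H3 (Hk 0)) as [_ H4].
  assert (H5 : 0 <= sqrt (radicand a c f g (s t) (k 0)) <= 2).
  { split; [apply sqrt_pos|].
    rewrite <- (sqrt_pow2 2) by lra; apply sqrt_le_1_alt; lra. }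
  assert (0 <= k 0 <= 1) by (generalize (Hk 0); unfold lo, hi; lra).
  assert (0 <= INR m) by apply pos_INR.
  unfold F; rewrite Rabs_pos_eq; nra.
- assert (Hyb : y 0 = b / 2).
  { assert (HF0 : F 0 (b / 2) = INR (S (S m)) * (b / 2)).
    { unfold F, s, k; rewrite !clamp_id by (unfold lo, hi; lra).
      unfold radicand; rewrite Hf0, Hg0; fold b.
      replace (a * 1 * (c * 0 ^ 2 * (b / 2) ^ 2 - 2 * (b / 2)) + b * (1 * 1))
        with (b ^ 2) by (unfold b; field).
      rewrite sqrt_pow2 by lra; rewrite !S_INR; field. }
    (* Both [y 0] and [b / 2] solve [(m + 2) x = F 0 x], while [F 0] is [m]-Lipschitz, so they
       coincide. *)
    assert (H := HL 0 (y 0) (b / 2)).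
    rewrite <- Hy0, HF0, <- Rmult_minus_distr_l, Rabs_mult in H.
    rewrite Rabs_pos_eq in H by apply pos_INR; rewrite !S_INR in H.
    assert (Hz : Rabs (y 0 - b / 2) = 0) by (generalize (Rabs_pos (y 0 - b / 2)); lra).
    apply Rabs_eq_0 in Hz; lra. }
  (* By continuity [y] stays within the half-width [b^2/8] of the box near 0, where both clamps are
     inactive. *)
  destruct (Hyc 0 (b ^ 2 / 8)) as [d [Hd Hyd]]; [lra|].
  assert (Hin : forall t, 0 <= t < Rmin d tau -> s t = t /\ k (y t) = y t).
  { intros t Ht; generalize (Rmin_l d tau) (Rmin_r d tau); intros.
    split; apply clamp_id; [lra|].
    destruct (Req_dec t 0) as [->|Ht0]; [rewrite Hyb; unfold lo, hi; lra|].
    specialize (Hyd t); simpl in Hyd; unfold Rdist in Hyd.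
    rewrite Hyb, Rminus_0_r, (Rabs_pos_eq t) in Hyd by lra.
    assert (Hyt : Rabs (y t - b / 2) < b ^ 2 / 8)
      by (apply Hyd; split; [split; [exact I | auto] | lra]).
    apply Rabs_def2 in Hyt; unfold lo, hi; lra. }
  exists (Rmin d tau), y; split; [apply Rmin_pos; lra|].
  split; [exact Hyc|]; split; [exact Hyb|]; split.
  + intros t Ht; destruct (Hin t Ht) as [Hst Hkt].
    destruct (Hbox (s t) (Hs t)) as [H1 [H2 H3]].
    destruct (radicand_box a c f g (s t) (k (y t)) Ha H1 H2 H3 (Hk (y t))) as [H4 _].
    rewrite Hst, Hkt in H4; fold b in H4; nra.
  + intros t Ht; destruct (Hin t ltac:(lra)) as [Hst Hkt].
    evar_last; [apply Hy; lra|].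
    unfold F; rewrite Hst, Hkt, !S_INR; field; lra.
Qed.

Ltac prove_smooth := repeat first
  [ assumption | apply smooth_upto_const | apply smooth_upto_id
  | apply smooth_upto_minus | apply smooth_upto_plus | apply smooth_upto_mult
  | apply smooth_upto_pow ].

(* [A] and [B] come from differentiating [t y' + 2 y = sqrt (...)] and are as smooth
   as [y], so that [y] of class C^k implies [y'] of class C^k. *)
Lemma reduced_equation_smooth (a c eps : R) (f g y : R -> R) :
  0 <= a < 1 -> 0 < eps -> f 0 = 1 -> g 0 = 1 ->
  (forall k, smooth_upto (initial_interval eps) k f) ->
  (forall k, smooth_upto (initial_interval eps) k g) ->
  continuity y -> y 0 = (1 - a) / 2 ->
  (forall t, 0 <= t < eps -> 0 < radicand a c f g t (y t)) ->
  (forall t, 0 < t < eps ->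
     is_derive y t ((sqrt (radicand a c f g t (y t)) - 2 * y t) / t)) ->
  forall k, smooth_upto (initial_interval eps) k y.
Proof.
intros Ha Heps Hf0 Hg0 Hf Hg Hyc Hy0 Hpos Hy.
set (E := fun t => radicand a c f g t (y t)).
induction k as [|k IH].
- intros x _; apply (limit1_imp _ (D_x no_cond x)); [|apply Hyc].
  intros t [_ Ht]; now split.
- destruct (Hf (S k)) as [f' [Hff' Hf']], (Hg (S k)) as [g' [Hgg' Hg']].
  assert (Hfk := Hf k); assert (Hgk := Hg k).
  assert (HE : smooth_upto (initial_interval eps) k E) by (unfold E, radicand; prove_smooth).
  assert (Hrho : smooth_upto (initial_interval eps) k (fun t => / sqrt (E t)))
    by now apply smooth_upto_inv_sqrt.
  set (p := fun t => (sqrt (E t) - 2 * y t) / t).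
  set (A := fun t => a * f t * (c * t ^ 2 * y t - 1) * / sqrt (E t) - 3).
  set (B := fun t => (a * f' t * (c * t ^ 2 * y t ^ 2 - 2 * y t)
    + a * f t * (2 * c * t * y t ^ 2) + (1 - a) * (f' t * g t + f t * g' t))
    * (1 / 2 * / sqrt (E t))).
  assert (Hsqrt0 : sqrt (E 0) = 1 - a).
  { rewrite <- (sqrt_pow2 (1 - a)) by lra; f_equal; unfold E, radicand.
    rewrite Hf0, Hg0, Hy0; field. }
  destruct (singular_linear_smooth eps k A B p Heps) as [P [HP HPp]].
  (* Here [A 0 = - a / (1 - a) - 3], at most -3. *)
  + unfold A; rewrite Hsqrt0, Hf0.
    assert (0 <= a * / (1 - a)).
    { apply Rmult_le_pos; [lra|]; apply Rlt_le, Rinv_0_lt_compat; lra. }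
    nra.
  + unfold A; prove_smooth.
  + unfold B; prove_smooth.
  (* Writing the root as [E t * / sqrt (E t)] reduces its continuity to that of the inverse root.
     The limit is [(1 - a) - 2 * y 0 = 0]. *)
  + apply (limit1_ext (fun t => E t * / sqrt (E t) - 2 * y t)).
    { intros t Ht; assert (0 < E t) by (apply Hpos; lra).
      rewrite <- (sqrt_sqrt (E t)) at 1 by lra; unfold p; field.
      split; [lra|]; now apply Rgt_not_eq, sqrt_lt_R0. }
    apply (limit1_in_eq _ _ (E 0 * / sqrt (E 0) - 2 * y 0)).
    * apply (limit1_imp _ (D_x (initial_interval eps) 0)).
      { intros t Ht; split; [split|]; lra. }
      apply (smooth_upto_continue_in (initial_interval eps) k
        (fun t => E t * / sqrt (E t) - 2 * y t)); [prove_smooth | split; lra].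
    * assert (0 < E 0) by (apply Hpos; lra).
      rewrite <- (sqrt_sqrt (E 0)) at 1 by lra; rewrite Hsqrt0, Hy0; field; lra.
  + intros t Ht.
    assert (Hin := initial_interval_interior eps t Ht).
    assert (Hft := D_in_is_derive _ _ _ _ Hin (Hff' t (locally_singleton _ _ Hin))).
    assert (Hgt := D_in_is_derive _ _ _ _ Hin (Hgg' t (locally_singleton _ _ Hin))).
    assert (Hyt : is_derive y t (p t)) by now apply Hy.
    assert (HEt : 0 < E t) by (apply Hpos; lra).
    assert (Hs : 0 < sqrt (E t)) by now apply sqrt_lt_R0.
    (* The chain rule splits [E'] into its explicit [t]-part, giving [B], and its [y]-part times
       [p]. Differentiating [t p = sqrt E - 2 y] then gives [t p' = A p + B]. *)
    assert (HE' : is_derive E t (2 * sqrt (E t) * (B t + (A t + 3) * p t))).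
    { unfold E at 1, radicand; auto_derive.
      - repeat split; eexists; eassumption.
      - apply is_derive_unique in Hft, Hgt, Hyt.
        change (fun x => f x) with f; change (fun x => g x) with g;
        change (fun x => y x) with y.
        rewrite Hft, Hgt, Hyt; unfold A, B; field; lra. }
    unfold p at 1; auto_derive.
    * repeat split; try (eexists; eassumption); lra.
    * apply is_derive_unique in HE', Hyt.
      change (fun x => E x) with E; change (fun x => y x) with y.
      rewrite HE', Hyt; unfold p; field; lra.
  + exists P; split; [|exact HP].
    assert (HyP : forall t, 0 < t < eps -> is_derive y t (P t)).
    { intros t Ht; rewrite HPp by exact Ht; now apply Hy. }
    intros x Hx; destruct (Req_dec x 0) as [->|Hx0].
    * apply D_in_endpoint; [exact Heps | | | exact HyP];
        now apply (smooth_upto_continue_in _ k).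
    * apply (is_derive_D_in _ _ _ _ (P x)); [|reflexivity].
      apply HyP; unfold initial_interval in Hx; lra.
Qed.

(** * Existence and uniqueness for the original equation *)

Lemma solution_exists (n : nat) (phi psi : R -> R) :
  (2 <= n)%nat -> smooth_on half_line phi -> smooth_on half_line psi ->
  phi 0 = psi 0 -> phi 0 <> 0 ->
  exists eps w, is_solution n phi psi eps w.
Proof.
intros Hn Hphi Hpsi H0 Hc.
assert (HN : 2 <= INR n) by (apply (le_INR 2), Hn).
set (c := phi 0) in *; set (a := (INR n - 2) / (INR n - 1)).
assert (Ha : 0 <= a < 1).
{ unfold a; split; [apply Rdiv_le_0_compat; lra | apply Rlt_div_l; lra]. }
set (f := fun t => / c * phi t); set (g := fun t => / c * psi t).
assert (Hf : forall k, smooth_upto half_line k f).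
{ intro k; apply smooth_upto_mult; [apply smooth_upto_const|].
  now apply smooth_on_smooth_upto. }
assert (Hg : forall k, smooth_upto half_line k g).
{ intro k; apply smooth_upto_mult; [apply smooth_upto_const|].
  now apply smooth_on_smooth_upto. }
assert (Hf0 : f 0 = 1) by (apply Rinv_l; exact Hc).
assert (Hg0 : g 0 = 1) by (unfold g; rewrite <- H0; apply Rinv_l; exact Hc).
destruct (reduced_equation_existence a c f g Ha Hf0 Hg0 (Hf 0%nat) (Hg 0%nat))
  as [eps [y [Heps [Hyc [Hy0 [Hpos Hy]]]]]].
assert (Hsub : forall t, initial_interval eps t -> half_line t) by (intros t Ht; apply Ht).
assert (Hfe := fun k => smooth_upto_subset _ _ k f Hsub (Hf k)).
assert (Hge := fun k => smooth_upto_subset _ _ k g Hsub (Hg k)).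
assert (Hys := reduced_equation_smooth a c eps f g y Ha Heps Hf0 Hg0 Hfe Hge Hyc Hy0 Hpos Hy).
set (E := fun t => radicand a c f g t (y t)) in *.
set (w := fun t => c * t ^ 2 * y t).
(* This is [c t (t y' + 2 y) = c t sqrt E], again with the root written through its inverse. *)
set (w' := fun t => c * t * (E t * / sqrt (E t))).
assert (Hw : forall k, smooth_upto (initial_interval eps) k w).
{ intro k; generalize (Hys k); intro; unfold w; prove_smooth. }
assert (Hw' : smooth_upto (initial_interval eps) 0 w').
{ generalize (Hys 0%nat) (Hfe 0%nat) (Hge 0%nat); intros.
  assert (smooth_upto (initial_interval eps) 0 E) by (unfold E, radicand; prove_smooth).
  assert (smooth_upto (initial_interval eps) 0 (fun t => / sqrt (E t)))
    by now apply smooth_upto_inv_sqrt.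
  unfold w'; prove_smooth. }
assert (HE : forall t, 0 <= t < eps -> E t * / sqrt (E t) = sqrt (E t)).
{ intros t Ht; assert (HEt := Hpos t Ht).
  rewrite <- (sqrt_sqrt (E t)) at 1 by (apply Rlt_le, HEt).
  field; now apply Rgt_not_eq, sqrt_lt_R0. }
assert (Hder : forall t, 0 < t < eps -> is_derive w t (w' t)).
{ intros t Ht; assert (Hyt := Hy t Ht); fold (E t) in Hyt.
  unfold w; auto_derive; [eexists; eassumption|].
  apply is_derive_unique in Hyt; change (fun x => y x) with y.
  unfold w'; rewrite Hyt, HE by lra; field; lra. }
assert (HD0 : initial_interval eps 0) by (split; lra).
exists eps, w; split; [exact Heps|]; split.
{ apply smooth_upto_smooth_on; [apply initial_interval_adherent | exact Hw]. }
exists w'; split; [|split; [|split; [|split]]].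
- intros x Hx; destruct (Req_dec x 0) as [->|Hx0].
  + apply D_in_endpoint; [exact Heps | | | exact Hder].
    * exact (Hw 0%nat 0 HD0).
    * exact (Hw' 0 HD0).
  + apply (is_derive_D_in _ _ _ _ (w' x)); [|reflexivity].
    apply Hder; unfold initial_interval in Hx; lra.
- unfold w; ring.
- unfold w'; ring.
- intros t Ht; unfold w'; rewrite HE by exact Ht.
  rewrite !Rpow_mult_distr, pow2_sqrt by (apply Rlt_le, Hpos, Ht).
  unfold E, radicand, f, g, w, a; field; lra.
- intros t Ht; fold c; unfold w'; rewrite HE by lra.
  assert (0 < sqrt (E t)) by (apply sqrt_lt_R0, Hpos; lra).
  (* The square [c * c] is positive whatever the sign of [phi 0]. *)
  replace (c * t * sqrt (E t) * c) with (t * sqrt (E t) * (c * c)) by ring.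
  apply Rmult_lt_0_compat; [apply Rmult_lt_0_compat; lra | now apply Rsqr_pos_lt].
Qed.

(* The equation gives [(w1' - w2') (w1' + w2') = a phi (w1 - w2) (w1 + w2 - 2)] with
   [w1' + w2'] and [phi] of the sign of [phi 0], so [(w1 - w2)^2] is nonincreasing. *)
Lemma solution_unique (n : nat) (phi psi : R -> R) (eps1 eps2 : R) (w1 w2 : R -> R) :
  (2 <= n)%nat -> continue_in phi half_line 0 -> phi 0 <> 0 ->
  is_solution n phi psi eps1 w1 -> is_solution n phi psi eps2 w2 ->
  exists delta, 0 < delta <= Rmin eps1 eps2 /\
    forall t, 0 <= t < delta -> w1 t = w2 t.
Proof.
intros Hn Hphi Hc [He1 [_ [w1' [Hw1 [Hw10 [_ [Heq1 Hs1]]]]]]]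
  [He2 [_ [w2' [Hw2 [Hw20 [_ [Heq2 Hs2]]]]]]].
assert (HN : 2 <= INR n) by (apply (le_INR 2), Hn).
set (c := phi 0) in *.
assert (Hlim : forall eps w w', 0 < eps ->
  (forall t, initial_interval eps t -> D_in w w' (initial_interval eps) t) -> w 0 = 0 ->
  limit1_in w (fun t => 0 < t < eps) 0 0).
{ intros eps w w' He Hw Hw0; rewrite <- Hw0 at 1.
  apply (limit1_imp _ (D_x (initial_interval eps) 0)).
  - intros t Ht; split; [split|]; lra.
  - apply (cont_deriv _ w'), Hw; split; lra. }
assert (Hl1 := Hlim _ _ _ He1 Hw1 Hw10); assert (Hl2 := Hlim _ _ _ He2 Hw2 Hw20).
(* Radius 1 gives [w1 + w2 < 2]; the tolerance [Rabs c / 2] below keeps [phi] of the sign of [c]. *)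
destruct (limit1_in_locally w1 eps1 0 1 He1 Rlt_0_1 Hl1) as [d1 [Hd1 Hb1]].
destruct (limit1_in_locally w2 eps2 0 1 He2 Rlt_0_1 Hl2) as [d2 [Hd2 Hb2]].
destruct (continue_in_half_line_0 phi (Rabs c / 2) Hphi) as [d3 [Hd3 Hb3]].
{ generalize (Rabs_pos_lt c Hc); lra. }
set (d := Rmin (Rmin d1 d2) d3).
assert (Hd : 0 < d /\ d <= d1 /\ d <= d2 /\ d <= d3).
{ generalize (Rmin_l (Rmin d1 d2) d3) (Rmin_r (Rmin d1 d2) d3)
    (Rmin_l d1 d2) (Rmin_r d1 d2); fold d; intros.
  split; [repeat apply Rmin_pos; lra | lra]. }
assert (Hsq : forall t, 0 < t < d -> (w1 t - w2 t) ^ 2 <= 0).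
{ apply (nonpos_of_derive_nonpos (fun t => (w1 t - w2 t) ^ 2)
    (fun t => 2 * (w1 t - w2 t) * (w1' t - w2' t))).
  - intros t Ht.
    assert (Hi1 := initial_interval_interior eps1 t ltac:(lra)).
    assert (Hi2 := initial_interval_interior eps2 t ltac:(lra)).
    assert (H1 := D_in_is_derive _ _ _ _ Hi1 (Hw1 t (locally_singleton _ _ Hi1))).
    assert (H2 := D_in_is_derive _ _ _ _ Hi2 (Hw2 t (locally_singleton _ _ Hi2))).
    auto_derive; [repeat split; eexists; eassumption|].
    apply is_derive_unique in H1, H2.
    change (fun x => w1 x) with w1; change (fun x => w2 x) with w2.
    rewrite H1, H2; ring.
  - intros t Ht.
    specialize (Hb1 t ltac:(lra)); specialize (Hb2 t ltac:(lra)).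
    specialize (Hb3 t ltac:(lra)); fold c in Hb3.
    specialize (Heq1 t ltac:(split; lra)); specialize (Heq2 t ltac:(split; lra)).
    specialize (Hs1 t ltac:(lra)); specialize (Hs2 t ltac:(lra)).
    rewrite Rminus_0_r in Hb1, Hb2; apply Rabs_def2 in Hb1, Hb2.
    assert (Hpc : 0 < phi t * c) by (revert Hb3; split_Rabs; nra).
    set (a := (INR n - 2) / (INR n - 1)).
    assert (Ha : 0 <= a) by (apply Rdiv_le_0_compat; lra).
    assert (Hdiff : (w1' t - w2' t) * (w1' t + w2' t)
      = a * phi t * (w1 t - w2 t) * (w1 t + w2 t - 2)).
    { transitivity (w1' t ^ 2 - w2' t ^ 2); [ring|].
      rewrite Heq1, Heq2; unfold a; field; lra. }
    set (e := w1 t - w2 t) in *; set (X := w1' t - w2' t) in *.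
    (* Multiplying by the positive factor [(w1' t + w2' t) * c] reveals the sign of [e * X] without
       a division. *)
    assert (Hprod : e * X * ((w1' t + w2' t) * c) <= 0).
    { replace (e * X * ((w1' t + w2' t) * c)) with (e * c * (X * (w1' t + w2' t))) by ring.
      rewrite Hdiff.
      replace (e * c * (a * phi t * e * (w1 t + w2 t - 2)))
        with (- (a * (phi t * c) * e ^ 2 * (2 - (w1 t + w2 t)))) by ring.
      apply Rge_le, Ropp_0_le_ge_contravar.
      apply Rmult_le_pos; [|lra]; apply Rmult_le_pos; [|apply pow2_ge_0].
      apply Rmult_le_pos; lra. }
    apply Rnot_lt_le; intro Hlt; nra.
  - apply (limit1_ext (fun t => (w1 t - w2 t) * (w1 t - w2 t))); [intros; ring|].
    apply (limit1_in_eq _ _ ((0 - 0) * (0 - 0))); [|ring].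
    assert (Hm1 : limit1_in w1 (fun t => 0 < t < d) 0 0)
      by (apply limit1_imp with (2 := Hl1); intros; lra).
    assert (Hm2 : limit1_in w2 (fun t => 0 < t < d) 0 0)
      by (apply limit1_imp with (2 := Hl2); intros; lra).
    apply limit_mul; now apply limit_minus. }
exists d; split.
- split; [lra|]; apply Rmin_glb; lra.
- intros t Ht; destruct (Req_dec t 0) as [->|Ht0]; [congruence|].
  specialize (Hsq t ltac:(lra)).
  assert (w1 t - w2 t = 0) by nra; lra.
Qed.

Theorem proposition1 (n : nat) (phi psi : R -> R)
  (hn : (2 <= n)%nat)
  (hphi : smooth_on half_line phi)
  (hpsi : smooth_on half_line psi)
  (h0 : phi 0 = psi 0)
  (hne : phi 0 <> 0) :
  (exists (eps : R) (w : R -> R), is_solution n phi psi eps w) /\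
  (forall (eps1 eps2 : R) (w1 w2 : R -> R),
     is_solution n phi psi eps1 w1 ->
     is_solution n phi psi eps2 w2 ->
     exists delta : R,
       0 < delta <= Rmin eps1 eps2 /\
       forall t : R, 0 <= t < delta -> w1 t = w2 t).
Proof.
split.
- now apply solution_exists.
- intros eps1 eps2 w1 w2; apply solution_unique; [exact hn | | exact hne].
  apply (smooth_on_smooth_upto half_line phi 0 hphi), Rle_refl.
Qed.
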